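(* Let $f\colon\mathbb{S}\to\mathbb{S}$ be a continuous circle map of degree $d\geq 1$ and let $F\colon\mathbb{R}\to\mathbb{R}$ be a lifting of $f$. If there exists a periodic orbit $P\subset\mathbb{R}$ of $F$ such that $\max P-\min P>1$, then $f$ has periodic points of all periods, that is, for every integer $m\geq 1$ there is a point of $\mathbb{S}$ that is periodic for $f$ with period $m$.
   Context: $\mathbb{S}=\mathbb{R}/\mathbb{Z}$ and $\pi\colon\mathbb{R}\to\mathbb{S}$ is the canonical projection. A lifting of a continuous map $f\colon\mathbb{S}\to\mathbb{S}$ is a continuous map $F\colon\mathbb{R}\to\mathbb{R}$ with $f\circ\pi=\pi\circ F$. The degree of $f$ (or of $F$) is the integer $d$ such that $F(x+1)=F(x)+d$ for all $x\in\mathbb{R}$. For a self-map $g$ of a set ($g=F$ on $\mathbb{R}$ or $g=f$ on $\mathbb{S}$), a point $x$ is periodic if $g^k(x)=x$ for some integer $k\geq 1$; its period is the least such $k$. A periodic orbit is the finite set $\{g^i(x)\mid i\geq 0\}$ for some periodic point $x$. In particular a periodic orbit of $F$ is a finite subset of $\mathbb{R}$ (periodicity is in $\mathbb{R}$, not modulo 1). *)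

(* Defs.v *)
From HB Require Import structures.
From mathcomp Require Import all_boot all_order all_algebra.
From mathcomp Require Import all_classical all_reals.
From mathcomp Require Import topology normedtype.

Set Implicit Arguments.
Unset Strict Implicit.
Unset Printing Implicit Defensive.

Import Order.TTheory GRing.Theory Num.Theory.
Import numFieldNormedType.Exports.

Local Open Scope classical_set_scope.
Local Open Scope ring_scope.
Local Open Scope quotient_scope.

Section Circle.
Variable R : realType.

Definition circle_rel (x y : R) : bool := x - y \is a Num.int.

Fact circle_rel_refl : reflexive circle_rel.
Proof. by move=> x; rewrite /circle_rel subrr rpred0. Qed.

Fact circle_rel_sym : symmetric circle_rel.
Proof. by move=> x y; rewrite /circle_rel -opprB rpredN. Qed.

Fact circle_rel_trans : transitive circle_rel.
Proof.
move=> y x z xy yz; rewrite /circle_rel -(subrK y x) -addrA.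
exact: rpredD xy yz.
Qed.

Definition circle_equiv :=
  EquivRel circle_rel circle_rel_refl circle_rel_sym circle_rel_trans.

Definition circle : Type := {eq_quot circle_equiv}.

HB.instance Definition _ := Topological.copy circle (quotient_topology circle).
HB.instance Definition _ := Quotient.on circle.

Definition circle_proj (x : R) : circle := \pi_circle x.

Lemma circle_projE (x y : R) :
  circle_proj x = circle_proj y <-> x - y \is a Num.int.
Proof. by split=> [/eqmodP|xy]; [|apply/eqmodP]. Qed.

Definition lifting (f : circle -> circle) (F : R -> R) : Prop :=
  continuous F /\ f \o circle_proj = circle_proj \o F.

(* The degree of a circle map f is by definition the integer d satisfying this
   equation for a lifting F of f. *)
Definition has_degree (F : R -> R) (d : int) : Prop :=
  forall x, F (x + 1) = F x + d%:~R.

Definition is_max (P : set R) (a : R) : Prop := P a /\ ubound P a.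
Definition is_min (P : set R) (a : R) : Prop := P a /\ lbound P a.

End Circle.

Section Periodicity.
Variables (T : Type) (g : T -> T).

Definition periodic_point (x : T) : Prop :=
  exists k : nat, (1 <= k)%N /\ iter k g x = x.

Definition has_period (x : T) (m : nat) : Prop :=
  [/\ (1 <= m)%N, iter m g x = x &
      forall k : nat, (1 <= k)%N -> iter k g x = x -> (m <= k)%N].

Definition periodic_orbit (P : set T) : Prop :=
  exists x, periodic_point x /\ P = [set iter i g x | i in [set: nat]].

End Periodicity.

(* Main.v *)
Require Import Defs.
From mathcomp Require Import all_boot all_order all_algebra.
From mathcomp Require Import all_classical all_reals.
From mathcomp Require Import topology normedtype.
From mathcomp Require Import ring lra zify.
Import Order.TTheory GRing.Theory Num.Theory.
Import numFieldNormedType.Exports.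
Local Open Scope classical_set_scope.
Local Open Scope ring_scope.

(** The period under [f] of the class of [x] is the least [k >= 1] such that
    [iter k F x - x] is an integer, so everything happens on the real line.

    If [d >= 2], then [iter m F x - x] has degree [d ^ m - 1 >= 1], hence takes
    every real value, in particular [1].  A point with [iter m F x = x + 1] has
    period exactly [m] on the circle: if [iter k F x = x + j], computing
    [iter (k + m) F x] in two ways gives [j (d ^ m - 1) = d ^ k - 1], which is
    positive, so [d ^ m <= d ^ k] ([periods_expanding]).

    If [d = 1], a point of period [m] on the line projects to a point of period
    [m] on the circle, because a nonzero integer drift would accumulate
    ([has_period_degree1]).  It remains to find on the line points of every
    period, and for this a horseshoe [z < p < q] with [F z = z], [q <= F p] and
    [F q <= z] is enough ([horseshoe_periods]).  The orbit [P] provides one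
    ([degree1_horseshoe]).  Let [a] and [b] be its extrema and [z] the largest
    fixed point below [a]; then [a < z + 1 < b], as [z + 1] is fixed as well and
    [b - a > 1].  Travelling from [b] to [a], the orbit jumps over [z + 1]
    leftwards from some point [r], so [q = r - 1 < b] satisfies [z < q] and
    [F q <= z].  Moreover [q > a], since [F] is above the identity on [(z, a]].
    Travelling from [a] to [b], the orbit jumps over [q] rightwards from some
    point [p]. *)

(** * Crossing points of continuous functions *)

Lemma continuous_iter (T : topologicalType) (g : T -> T) (n : nat) :
  continuous g -> continuous (iter n g).
Proof.
move=> gc; elim: n => [|n IHn] x; first exact: cvg_id.
exact: (continuous_comp (IHn x) (gc _)).
Qed.

Lemma continuous_IVT {R : realType} (G : R -> R) (a b v : R) :
  continuous G -> a <= b -> G a <= v <= G b \/ G b <= v <= G a ->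
  exists x, a <= x <= b /\ G x = v.
Proof.
move=> Gc ab v_ab.
have [||x] := @IVT R G a b v ab; first exact: continuous_subspaceT.
  rewrite ge_min le_max.
  by case: v_ab => /andP[-> ->]; rewrite ?orbT.
by rewrite in_itv /= => xab Gx; exists x.
Qed.

Lemma fixed_point_between {R : realType} (G : R -> R) (a b : R) :
  continuous G -> a <= b -> a <= G a /\ G b <= b \/ G a <= a /\ b <= G b ->
  exists x, a <= x <= b /\ G x = x.
Proof.
move=> Gc ab Gab.
have Hc : continuous (fun x => G x - x).
  by move=> x; apply: cvgB; [exact: Gc | exact: cvg_id].
have [|x [xab Gx]] := @continuous_IVT R _ a b 0 Hc ab.
  by case: Gab => -[? ?]; [right|left]; lra.
by exists x; split=> //; lra.
Qed.

Lemma closed_has_max {R : realType} (A : set R) :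
  closed A -> A !=set0 -> has_ubound A -> exists s, is_max A s.
Proof.
move=> Acl A0 Aub; exists (sup A); split; last by move=> x; exact: ub_le_sup.
by have := closure_sup A0 Aub; rewrite -((closure_id A).1 Acl).
Qed.

Lemma last_crossing {R : realType} (G : R -> R) (a b y : R) :
  continuous G -> a <= b -> G b <= y <= G a ->
  exists s, [/\ a <= s <= b, G s = y & forall x, s <= x <= b -> G x <= y].
Proof.
move=> Gc ab /andP[Gby yGa].
pose A := [set x | a <= x <= b /\ y <= G x].
have [|||s [[sab yGs] sub]] := @closed_has_max R A.
- have -> : A = [set x | a <= x] `&` [set x | x <= b] `&` G @^-1` [set x | y <= x].
    apply/seteqP; split=> x [].
      by move=> /andP[? ?] ?.
    by move=> [/= ? ?] ?; split=> //; apply/andP.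
  apply: closedI; first by apply: closedI; [exact: closed_ge|exact: closed_le].
  by apply: closed_comp; [move=> x _; exact: Gc|exact: closed_ge].
- by exists a; split=> //; rewrite lexx.
- by exists b => x [/andP[]].
have [|||x [xsb Gx]] := @continuous_IVT R G s b y => //; try lra.
have xs : x = s by apply/eqP; rewrite eq_le sub //=; [lra|split; lra].
subst x; exists s; split=> // x xsb'.
rewrite leNgt; apply/negP => yGx.
have xs : x <= s by apply: sub; split; lra.
by have xs' : x = s; [lra|subst x; lra].
Qed.

(** The mirror image of [last_crossing] under [x |-> - x]. *)
Lemma first_crossing {R : realType} (G : R -> R) (a b y : R) :
  continuous G -> a <= b -> G a <= y <= G b ->
  exists u, [/\ a <= u <= b, G u = y & forall x, a <= x <= u -> G x <= y].
Proof.
move=> Gc ab yab.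
have [|||s [sab Gs Gle]] := @last_crossing R (G \o -%R) (- b) (- a) y.
- by move=> x; apply: continuous_comp; [exact: continuousN|exact: Gc].
- by lra.
- by rewrite /= !opprK.
exists (- s); split=> //; first by lra.
by move=> x xas; rewrite -[x]opprK; apply: Gle; lra.
Qed.

(** * Periodic points of a horseshoe *)

(** Successive preimages of [p] along the branch of [G] over [[z, p]]: they
    delimit intervals starting at the fixed point [z] whose points stay left of
    [p] for [n] steps, while the endpoint [y] is finally thrown beyond [q].
    Taking each time the first preimage keeps the image of the new interval
    inside the previous one; the lower bound [z <= G x] does the rest. *)
Lemma left_branch {R : realType} (G : R -> R) (z p q : R) (n : nat) :
  continuous G -> (forall x, z <= G x) -> z < p < q ->
  G z = z -> q <= G p ->
  exists y, [/\ z <= y <= p, q <= iter n.+1 G y &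
    forall x k, z <= x <= y -> (k <= n)%N -> iter k G x <= p].
Proof.
move=> Gc zG zpq Gz qGp; elim: n => [|n [y [yzp qGy Gle]]].
  exists p; split=> //; first by lra.
  by move=> x k xzp; rewrite leqn0 => /eqP -> /=; lra.
have [|||u [uzp Gu Gley]] := @first_crossing R G z p y => //; try lra.
exists u; split=> //; first by rewrite iterSr Gu.
move=> x [|k] xzu kn; first by rewrite /=; lra.
by rewrite iterSr; apply: Gle => //; rewrite zG Gley.
Qed.

(** The point found makes one step from the right of [p] to the left of [p],
    stays there until time [n + 1], and comes back at time [n + 2]; since all
    intermediate iterates lie on the other side of [p], its period is exactly
    [n + 2]. *)
Lemma unimodal_periods {R : realType} (G : R -> R) (z p q : R) (n : nat) :
  continuous G -> (forall x, z <= G x) -> z < p < q ->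
  G z = z -> q <= G p -> G q = z ->
  exists x, z < x /\ has_period G x n.+2.
Proof.
move=> Gc zG zpq Gz qGp Gq.
have [y [yzp qGy Gle]] := @left_branch R G z p q n Gc zG zpq Gz qGp.
(* [G] maps [[s, q]] into [[z, y]], and [iter n.+2 G] moves [s] to the right
   and [q] to the left. *)
have [|||s [spq Gs Gley]] := @last_crossing R G p q y => //; try lra.
have iterz k : iter k G z = z by elim: k => //= k ->.
have [|||x [xsq Gx]] := @fixed_point_between R (iter n.+2 G) s q.
- exact: continuous_iter.
- by lra.
- by left; rewrite !(iterSr n.+1) Gs Gq iterz; lra.
have Gxy : G x <= y by exact: Gley.
have px : p < x.
  rewrite lt_neqAle; apply/andP; split; last by lra.
  by apply/eqP => px; subst x; lra.
exists x; split; first by lra.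
split=> // -[//|k] _ kx; rewrite leqNgt; apply/negP => kn.
have : iter k.+1 G x <= p by rewrite iterSr; apply: Gle => //; rewrite zG Gxy.
by rewrite kx; lra.
Qed.

(** Truncating [F] from below at [z] reduces to [unimodal_periods].  The
    truncation creates no periodic point other than [z]: once an orbit of the
    truncated map reaches [z] it stays there. *)
Lemma horseshoe_periods {R : realType} {F : R -> R} {z p q : R} {m : nat} :
  continuous F -> z < p < q -> F z = z -> q <= F p -> F q <= z ->
  (1 <= m)%N -> exists x, has_period F x m.
Proof.
move=> Fc zpq Fz qFp Fqz; case: m => [//|[_|n _]]; first by exists z; split.
pose G x := Num.max (F x) z.
have [||||||x [zx [_ Gx xmin]]] := @unimodal_periods R G z p q n.
- by move=> x; apply: continuous_max; [exact: Fc|exact: cvg_cst].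
- by move=> x; rewrite /G le_max lexx orbT.
- exact: zpq.
- by rewrite /G Fz maxxx.
- by rewrite /G le_max qFp.
- by rewrite /G; apply/max_idPr.
have Gz k : iter k G z = z by elim: k => //= k ->; rewrite /G Fz maxxx.
(* An orbit returning to [x > z] never meets [z], hence never meets the
   truncation. *)
have Gnz k : iter k G x <> z.
  move=> kz; have : iter (k * n.+2) G x = x.
    by rewrite mulnC; elim: k {kz} => [|k IHk]; rewrite ?muln0 // mulnS addnC iterD Gx.
  have -> : (k * n.+2 = k * n.+1 + k)%N by lia.
  by rewrite iterD kz Gz; lra.
have FG k : iter k F x = iter k G x.
  elim: k => //= k ->; have := Gnz k.+1.
  by rewrite /= /G; case: (leP z (F (iter k G x))) => // /ltW /max_idPr ->.
by exists x; split=> // [|k]; rewrite FG //; exact: xmin.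
Qed.

(** * Transitivity of periodic orbits *)

Lemma periodic_orbit_reaches {T : Type} {g : T -> T} {P : set T} {x y : T} :
  periodic_orbit g P -> P x -> P y -> exists n, y = iter n g x.
Proof.
move=> [x0 [[k [k1 kx0]] ->]] [i _ <-] [j _ <-].
(* Completing [i] steps to [k * i] leads back to the base point [x0]. *)
exists (j + (k * i - i))%N; rewrite -iterD -addnA subnK ?leq_pmull //.
rewrite iterD; congr iter; elim: i => [|i IHi]; first by rewrite muln0.
by rewrite mulnS addnC iterD kx0.
Qed.

Lemma periodic_orbit_leaves {T : Type} {g : T -> T} {P : set T} (A : set T) {x y : T} :
  periodic_orbit g P -> P x -> P y -> A x -> ~ A y ->
  exists r, [/\ P r, A r & ~ A (g r)].
Proof.
move=> Porb Px Py Ax; have [n ->] := periodic_orbit_reaches Porb Px Py.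
have Pg i : P (iter i g x).
  have [x0 [_ PE]] := Porb; move: Px; rewrite PE => -[j _ <-].
  by exists (i + j)%N => //; rewrite iterD.
elim: n => [//|n IHn] nAn.
have [An|/IHn //] := pselect (A (iter n g x)).
by exists (iter n g x); split.
Qed.

(** * From the line to the circle *)

Lemma degree_iter {R : realType} {F : R -> R} {d : int} (n : nat) (j : int) :
  has_degree F d ->
  forall x, iter n F (x + j%:~R) = iter n F x + (d ^+ n * j)%:~R.
Proof.
move=> Fd.
have Fnat (i : nat) x : F (x + i%:R) = F x + d%:~R * i%:R.
  elim: i => [|i IHi]; first by rewrite mulr0 !addr0.
  by rewrite -natr1 addrA Fd IHi; ring.
have Fj i x : F (x + i%:~R) = F x + (d * i)%:~R.
  rewrite intrM; case: i => i; first exact: Fnat.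
  rewrite NegzE mulrNz -[in RHS](subrK (i.+1%:~R) x) Fnat.
  rewrite -[(Posz _)%:~R]/(i.+1%:R); ring.
move=> x; elim: n => [|n IHn]; first by rewrite expr0 mul1r.
by rewrite !iterS IHn Fj exprS mulrA.
Qed.

Lemma iter_lifting {R : realType} {f : circle R -> circle R} {F : R -> R} n x :
  lifting f F -> iter n f (circle_proj x) = circle_proj (iter n F x).
Proof.
move=> [_ fF]; elim: n => //= n ->.
by rewrite -[LHS]/((f \o @circle_proj R) _) fF.
Qed.

Lemma circle_period {R : realType} {f : circle R -> circle R} {F : R -> R}
    {m : nat} {x : R} :
  lifting f F -> (1 <= m)%N -> (exists j : int, iter m F x = x + j%:~R) ->
  (forall (k : nat) (j : int), (1 <= k)%N -> iter k F x = x + j%:~R -> (m <= k)%N) ->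
  has_period f (circle_proj x) m.
Proof.
move=> fF m1 [j mx] xmin; split=> // [|k k1].
  by rewrite (iter_lifting _ _ fF) mx; apply/circle_projE; rewrite addrC addKr intr_int.
rewrite (iter_lifting _ _ fF) => /circle_projE /intrP[i kx].
by apply: (xmin k i k1); rewrite -kx addrC subrK.
Qed.

(** * Degree at least two *)

(** Looking for points with translation number exactly [1] excludes smaller
    periods at once: such a point of period [k] and translation [j] would have
    [j (d ^ m - 1) = d ^ k - 1 > 0], impossible when [k < m]. *)
Lemma periods_expanding {R : realType} {f : circle R -> circle R} {F : R -> R}
    {d : int} {m : nat} :
  lifting f F -> has_degree F d -> 2 <= d -> (1 <= m)%N ->
  exists x : circle R, has_period f x m.
Proof.
move=> fF Fd d2 m1.
have dm : 2 <= d ^+ m.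
  by rewrite (le_trans d2) // ler_eXnr //; lia.
have dmR : 2 <= (d ^+ m)%:~R :> R by rewrite (ler_int R 2).
pose H x := iter m F x - x.
have Hc : continuous H.
  move=> x; apply: cvgB; last exact: cvg_id.
  by apply: continuous_iter; case: fF.
pose c := iter m F 0 - 1.
pose N := Num.bound `|c|.
have cN : `|c| <= N%:R by apply/ltW/archi_boundP; exact: normr_ge0.
have HE (j : int) : H j%:~R = c + 1 + ((d ^+ m)%:~R - 1) * j%:~R.
  by rewrite /H -[in iter _ _ _](add0r j%:~R) (degree_iter _ _ Fd) intrM /c; ring.
have [|||x [_ Hx]] := @continuous_IVT R H (- N%:R) N%:R 1 => //.
- by rewrite (le_trans (y := 0)) // ?oppr_le0.
- left; have := HE N; have := HE (- N%:Z).
  rewrite mulrNz -[(Posz N)%:~R]/(N%:R) => -> ->.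
  by move: cN; rewrite ler_norml; nra.
have mx : iter m F x = x + 1%:~R by rewrite /H in Hx; lra.
exists (circle_proj x); apply: (circle_period fF m1); first by exists 1.
move=> k j k1 kx.
(* Both sides are [iter (k + m) F x]. *)
have : x + 1%:~R + (d ^+ m * j)%:~R = x + j%:~R + (d ^+ k * 1)%:~R.
  by rewrite -mx -(degree_iter _ _ Fd) -kx -iterD addnC iterD mx (degree_iter _ _ Fd).
rewrite -!addrA => /addrI; rewrite -!intrD => /intr_inj jE.
have dk : 2 <= d ^+ k by rewrite (le_trans d2) // ler_eXnr //; lia.
have d1 : 1 < d by exact: lt_le_trans d2.
rewrite -(ler_eXn2l (x := d)) //.
move: (d ^+ m) (d ^+ k) dm dk jE => D E; clear => D2 E2 jE.
have j1 : 1 <= j by nia.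
by nia.
Qed.

(** * Degree one *)

(** In degree one, [iter k F x = x + j] gives [iter (m * k) F x = x + m * j]; on
    a periodic orbit of the line this drift vanishes, so periods are the same on
    the line and on the circle. *)
Lemma has_period_degree1 {R : realType} {f : circle R -> circle R} {F : R -> R}
    {m : nat} {x : R} :
  lifting f F -> has_degree F 1 -> has_period F x m ->
  has_period f (circle_proj x) m.
Proof.
move=> fF F1 [m1 mx xmin].
apply: (circle_period fF m1); first by exists 0; rewrite addr0.
move=> k j k1 kx; apply: xmin => //.
have drift n : iter (n * k) F x = x + (n%:Z * j)%:~R.
  elim: n => [|n IHn]; first by rewrite mul0r addr0.
  rewrite mulSn iterD IHn (degree_iter _ _ F1) expr1n mul1r kx.
  by rewrite -addrA -intrD; congr (x + _%:~R); lia.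
have : iter (m * k) F x = x.
  by rewrite mulnC; elim: k {k1 kx drift} => // k IHk; rewrite mulSn iterD IHk.
rewrite drift -[RHS]addr0 => /addrI /eqP.
by rewrite intr_eq0 mulf_eq0 => /orP[|/eqP j0]; [lia|rewrite kx j0 addr0].
Qed.

(** Both jumps are made by points of the orbit itself; the translation by [1]
    between [r] and [q] is where the hypothesis [1 < b - a] enters, as it leaves
    room for both [q] and [z + 1] to the left of [b]. *)
Lemma degree1_horseshoe {R : realType} {F : R -> R} {P : set R} {a b : R} :
  continuous F -> has_degree F 1 -> periodic_orbit F P ->
  is_min P a -> is_max P b -> 1 < b - a ->
  exists z p q, [/\ z < p < q, F z = z, q <= F p & F q <= z].
Proof.
move=> Fc F1 Porb [Pa aP] [Pb bP] ab.
have PF x : P x -> P (F x).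
  by have [x0 [_ ->]] := Porb => -[i _ <-]; exists i.+1.
have aFa : a <= F a by apply/aP/PF.
have Fbb : F b <= b by apply/bP/PF.
have Fj x j : F (x + j%:~R) = F x + j%:~R.
  by have := degree_iter 1 j F1 x; rewrite expr1n mul1r.
have [|||c [cab Fcc]] := @fixed_point_between R F a b => //; [lra|by left|].
have [|||z [[za Fz] zmax]] := @closed_has_max R [set x | x <= a /\ F x = x].
- have -> : [set x | x <= a /\ F x = x] =
      [set x | x <= a] `&` (fun x => F x - x) @^-1` [set x | x = 0].
    by apply/seteqP; split=> x /= [xa Fx]; split=> //; lra.
  apply: closedI; first exact: closed_le.
  apply: closed_comp; last exact: closed_eq.
  by move=> x _; apply: cvgB; [exact: Fc | exact: cvg_id].
(* Some integer translate of the fixed point [c] lies below [a]. *)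
- exists (c + (- (Num.bound (c - a))%:Z)%:~R); split; last by rewrite Fj Fcc.
  have := @archi_boundP R (c - a); rewrite mulrNz -[(Posz _)%:~R]/(_%:R); lra.
- by exists a => x [].
(* If [a] were fixed, its orbit [P] would be a single point. *)
have {}za : z < a.
  rewrite lt_neqAle za andbT; apply/eqP => zE; subst z.
  have [n bE] := periodic_orbit_reaches Porb Pa Pb.
  have : iter n F a = a by elim: n {bE} => //= n ->.
  by rewrite -bE; lra.
(* Otherwise [z + 1] is a fixed point below [a] larger than [z]. *)
have az1 : a < z + 1.
  rewrite ltNge; apply/negP => z1a.
  by have : z + 1 <= z; [apply: zmax; split=> //; rewrite F1 Fz|lra].
have [||r [Pr z1r /negP]] :=
  periodic_orbit_leaves [set x | z + 1 < x] Porb Pb Pa.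
- by rewrite /=; lra.
- by rewrite /=; lra.
rewrite -leNgt /= => Frz1.
have rb : r <= b by exact: bP.
have FE : F r = F (r - 1) + 1 by rewrite -F1 subrK.
(* Otherwise [F] has a fixed point between [r - 1] and [a], where
   [F (r - 1) <= z < r - 1] and [a <= F a]. *)
have aq : a < r - 1.
  rewrite ltNge; apply/negP => qa.
  have [|||x [xqa Fx]] := @fixed_point_between R F (r - 1) a => //.
    by right; rewrite /= in z1r; lra.
  have : x <= z by apply: zmax; split=> //; lra.
  by rewrite /= in z1r; lra.
have [||p [Pp pq /negP]] :=
  periodic_orbit_leaves [set x | x < r - 1] Porb Pa Pb.
- by rewrite /=; lra.
- by rewrite /=; lra.
rewrite -leNgt /= => qFp; rewrite /= in pq.
have ap : a <= p by exact: aP.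
by exists z, p, (r - 1); split=> //; lra.
Qed.

Theorem corollary2p4 (R : realType) (f : circle R -> circle R) (F : R -> R)
    (d : int) (f_cont : continuous f) (F_lift : lifting f F)
    (F_deg : has_degree F d) (d_ge1 : 1 <= d)
    (hP : exists P : set R, periodic_orbit F P /\
       exists a b : R, [/\ is_min P a, is_max P b & 1 < b - a]) :
  forall m : nat, (1 <= m)%N -> exists x : circle R, has_period f x m.
Proof.
move=> m m1; have [d2|d1] := leP 2 d.
  exact: (periods_expanding F_lift F_deg d2 m1).
have dE : d = 1 by lia.
subst d; have [P [Porb [a [b [Pa Pb ab]]]]] := hP; have [Fc _] := F_lift.
have [z [p [q [zpq Fz qFp Fqz]]]] := degree1_horseshoe Fc F_deg Porb Pa Pb ab.
have [x Fx] := horseshoe_periods Fc zpq Fz qFp Fqz m1.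
by exists (circle_proj x); exact: (has_period_degree1 F_lift F_deg Fx).
Qed.
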